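(* Let $X\subseteq\mathbb{R}^m$, $Y\subseteq\mathbb{R}^n$ be nonempty, compact, convex sets, $A$ and $B$ real matrices of sizes $q\times n$ and $q\times m$, $b\in\mathbb{R}^q$, and let $\mathcal{Q}(x)=\inf\{f(y,x): y\in Y,\ Ay+Bx=b,\ g(y,x)\le0\}$ for $x\in X$, where $g=(g_1,\ldots,g_p)$. Assume: (H1) $f:\mathbb{R}^n\times\mathbb{R}^m\to\mathbb{R}\cup\{+\infty\}$ is lower semicontinuous, proper, and convex; (H2) each $g_i:\mathbb{R}^n\times\mathbb{R}^m\to\mathbb{R}\cup\{+\infty\}$ is convex and lower semicontinuous; (H3) $f$ is convex and differentiable on $Y\times X$, and for every $x\in X$ there exists $\alpha(x)>0$ such that $f(y_2,x)\ge f(y_1,x)+(y_2-y_1)^T\nabla_yf(y_1,x)+\frac{\alpha(x)}2\|y_2-y_1\|_2^2$ for all $y_1,y_2\in Y$; (H4) for every $y\in Y$ the function $f(y,\cdot)$ is differentiable on $X$ and for every $x\in X$ there exists $0\le M_1(x)<+\infty$ such that $\|\nabla_xf(y_2,x)-\nabla_xf(y_1,x)\|_2\le M_1(x)\|y_2-y_1\|_2$ for all $y_1,y_2\in Y$; (H5) if $Y$ is polyhedral then for every $x\in X$ there exists $y_x\in Y$ such that $Bx+Ay_x=b$ and $g(y_x,x)<0$, and if $Y$ is not polyhedral then for every $x\in X$ there exists $y_x\in\mathrm{ri}(Y)$ such that $Bx+Ay_x=b$ and $g(y_x,x)<0$; (H6) for every $x\in X$ there exist $\alpha_D(x)>0$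 and a convex set $D_x$ containing the set of optimal solutions of the dual problem $\sup_{(\lambda,\mu)\in\mathbb{R}^q\times\mathbb{R}^p_+}\theta_x(\lambda,\mu)$ such that the dual function $\theta_x$ is strongly concave on $D_x$ with constant of strong concavity $\alpha_D(x)$ with respect to $\|\cdot\|_2$; (H7) $g$ is differentiable on $Y\times X$ and for every $x\in X$ there exists $0\le M_2(x)<+\infty$ such that $\|\nabla_xg_i(y_1,x)-\nabla_xg_i(y_2,x)\|_2\le M_2(x)\|y_1-y_2\|_2$ for all $y_1,y_2\in Y$, $i=1,\ldots,p$. Let $\bar x\in X$ and $\varepsilon\ge0$, let $\hat y(\varepsilon)$ be an $\varepsilon$-optimal feasible solution of the problem defining $\mathcal{Q}(\bar x)$, and let $(\hat\lambda(\varepsilon),\hat\mu(\varepsilon))$ be an $\varepsilon$-optimal feasible solution of the dual problem $\sup_{(\lambda,\mu)\in\mathbb{R}^q\times\mathbb{R}^p_+}\theta_{\bar x}(\lambda,\mu)$ with $(\hat\lambda(\varepsilon),\hat\mu(\varepsilon))\in D_{\bar x}$. Let $U=\max_{i=1,\ldots,p}\|\nabla_xg_i(\hat y(\varepsilon),\bar x)\|_2$, let $\mathcal{L}_{\bar x}$ be any lower bound on $\mathcal{Q}(\bar x)$, and define $$\mathcal{U}_{\bar x}=\frac{f(y_{\bar x},\bar x)-\mathcal{L}_{\bar x}}{\min(-g_i(y_{\bar x},\bar x),\,i=1,\ldots,p)},$$ $$\eta(\varepsilon,\bar x)=\varepsilon+\Big((M_1(\bar x)+M_2(\bar x)\,\mathcal{U}_{\bar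 x})\sqrt{\tfrac{2}{\alpha(\bar x)}}+\frac{2\max(\|B^T\|,\sqrt p\,U)}{\sqrt{\alpha_D(\bar x)}}\Big)\mathrm{Diam}(X)\sqrt\varepsilon.$$ Then $$\mathcal{C}(x):=f(\hat y(\varepsilon),\bar x)-\eta(\varepsilon,\bar x)+\Big\langle\nabla_xf(\hat y(\varepsilon),\bar x)+B^T\hat\lambda(\varepsilon)+\sum_{i=1}^p\hat\mu_i(\varepsilon)\nabla_xg_i(\hat y(\varepsilon),\bar x),\ x-\bar x\Big\rangle$$ is a cut for $\mathcal{Q}$ at $\bar x$, i.e. $\mathcal{Q}(x)\ge\mathcal{C}(x)$ for all $x\in X$, and the distance $\mathcal{Q}(\bar x)-\mathcal{C}(\bar x)$ is at most $\eta(\varepsilon,\bar x)$.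
   Context: The dual function is $\theta_x(\lambda,\mu)=\inf_{y\in Y}\{f(y,x)+\lambda^T(Ay+Bx-b)+\mu^Tg(y,x)\}$. $\varepsilon$-optimal means feasible with objective value within $\varepsilon$ of the optimal value. $\mathrm{ri}$ denotes relative interior; $g(y_x,x)<0$ is componentwise; $\|B^T\|$ is the operator norm for $\|\cdot\|_2$; $\mathrm{Diam}(X)=\max_{x,x'\in X}\|x-x'\|_2$. A function $h$ is strongly concave on a convex set $D$ with constant $\alpha>0$ w.r.t. $\|\cdot\|_2$ if $h(tx+(1-t)y)\ge th(x)+(1-t)h(y)+\frac{\alpha t(1-t)}2\|y-x\|_2^2$ for all $x,y\in D$ where $h$ is finite and all $t\in[0,1]$. *)

(* Defs.v *)
From HB Require Import structures.
From mathcomp Require Import all_boot all_order all_algebra.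
From mathcomp Require Import all_classical all_reals all_analysis.

Set Implicit Arguments.
Unset Strict Implicit.
Unset Printing Implicit Defensive.

Import Order.TTheory GRing.Theory Num.Theory.
Import numFieldNormedType.Exports.

Local Open Scope classical_set_scope.
Local Open Scope ring_scope.

(* The MathComp-Analysis norm on matrices is the sup norm: it is only used here
   for the topology and for differentiability. All Euclidean quantities go
   through [norm2]. *)
Section euclidean.
Context {R : realType}.

Definition dotp n (u v : 'cV[R]_n) : R := (u^T *m v) ord0 ord0.

Definition norm2 n (u : 'cV[R]_n) : R := Num.sqrt (dotp u u).

Definition norm2_pair q p (z : 'cV[R]_q * 'cV[R]_p) : R :=
  norm2 (col_mx z.1 z.2).

Definition opnorm2 m n (M : 'M[R]_(m, n)) : R :=
  sup [set norm2 (M *m u) | u in [set u : 'cV[R]_n | norm2 u <= 1]].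

Definition diam2 n (X : set 'cV[R]_n) : R :=
  sup [set norm2 (z.1 - z.2) | z in X `*` X].

End euclidean.

Section convex_analysis.
Context {R : realType}.

Definition polyhedral n (Y : set 'cV[R]_n) : Prop :=
  exists k (C : 'M[R]_(k, n)) (d : 'cV[R]_k),
    Y = [set y | forall i, (C *m y) i ord0 <= d i ord0].

Definition affine_hull n (Y : set 'cV[R]_n) : set 'cV[R]_n :=
  [set z | exists k (t : 'I_k -> R) (v : 'I_k -> 'cV[R]_n),
    [/\ forall i, Y (v i), \sum_i t i = 1 & z = \sum_i t i *: v i]].

Definition relint n (Y : set 'cV[R]_n) : set 'cV[R]_n :=
  [set y | Y y /\ exists2 e : R, 0 < e &
    forall z, affine_hull Y z -> norm2 (z - y) < e -> Y z].

Local Open Scope ereal_scope.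

(* The library convention 0 * +oo = 0 makes the inequality hold at t = 0, 1. *)
Definition econvex_on (V : lmodType R) (D : set V) (h : V -> \bar R) : Prop :=
  forall (x y : V) (t : R), D x -> D y -> (0 <= t <= 1)%R ->
    h (t *: x + (1 - t) *: y)%R <= t%:E * h x + (1 - t)%:E * h y.

Definition eproper T (h : T -> \bar R) : Prop :=
  (forall z, h z != -oo) /\ (exists z, h z < +oo).

Definition strongly_concave_on (V : lmodType R) (N : V -> R) (alpha : R)
    (D : set V) (h : V -> \bar R) : Prop :=
  forall (x y : V) (t : R), D x -> D y ->
    h x \is a fin_num -> h y \is a fin_num -> (0 <= t <= 1)%R ->
    t%:E * h x + (1 - t)%:E * h y
      + (alpha * t * (1 - t) / 2 * N (y - x)%R ^+ 2)%:E
    <= h (t *: x + (1 - t) *: y)%R.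

(* Differentiability, at a point, of a function with values in R u {+oo}: it is
   finite near the point and differentiable there as a real function. *)
Definition ediff_at (V : normedModType R) (h : V -> \bar R) (z : V) : Prop :=
  (\forall w \near z, h w \is a fin_num) /\
  differentiable (fine \o h : V -> R^o) z.

Definition egrad n (h : 'cV[R]_n -> \bar R) (x : 'cV[R]_n) : 'cV[R]_n :=
  \col_i ('D_(delta_mx i ord0) (fine \o h : 'cV[R]_n -> R^o) x).

Definition eps_argmin T (S : set T) (h : T -> \bar R) (eps : R) : set T :=
  [set z | S z /\ h z <= ereal_inf (h @` S) + eps%:E].

Definition eps_argmax T (S : set T) (h : T -> \bar R) (eps : R) : set T :=
  [set z | S z /\ ereal_sup (h @` S) - eps%:E <= h z].

Definition argmax T (S : set T) (h : T -> \bar R) : set T :=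
  [set z | S z /\ h z = ereal_sup (h @` S)].

End convex_analysis.

Section problem.
Context {R : realType} {n m q p : nat}.
Variables (f : 'cV[R]_n * 'cV[R]_m -> \bar R)
          (g : 'I_p -> 'cV[R]_n * 'cV[R]_m -> \bar R)
          (A : 'M[R]_(q, n)) (B : 'M[R]_(q, m)) (b : 'cV[R]_q)
          (Y : set 'cV[R]_n).

Local Open Scope ereal_scope.

Definition gradx (h : 'cV[R]_n * 'cV[R]_m -> \bar R) (y : 'cV[R]_n)
    (x : 'cV[R]_m) : 'cV[R]_m := egrad (fun x' => h (y, x')) x.

Definition grady (h : 'cV[R]_n * 'cV[R]_m -> \bar R) (y : 'cV[R]_n)
    (x : 'cV[R]_m) : 'cV[R]_n := egrad (fun y' => h (y', x)) y.

Definition feasible (x : 'cV[R]_m) : set 'cV[R]_n :=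
  [set y | [/\ Y y, (A *m y + B *m x)%R = b & forall i, g i (y, x) <= 0]].

Definition value_fun (x : 'cV[R]_m) : \bar R :=
  ereal_inf [set f (y, x) | y in feasible x].

Definition dual_feasible : set ('cV[R]_q * 'cV[R]_p) :=
  [set z : 'cV[R]_q * 'cV[R]_p | forall i, (0 <= z.2 i ord0)%R].

Definition dual_fun (x : 'cV[R]_m) (z : 'cV[R]_q * 'cV[R]_p) : \bar R :=
  ereal_inf [set f (y, x) + (dotp z.1 (A *m y + B *m x - b)%R)%:E
                 + \sum_(i < p) ((z.2 i ord0)%:E * g i (y, x)) | y in Y].

End problem.

(* Main.v *)
Require Import Defs.
From HB Require Import structures.
From mathcomp Require Import all_boot all_order all_algebra.
From mathcomp Require Import all_classical all_reals all_analysis.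
From mathcomp Require Import ring lra.

Set Implicit Arguments.
Unset Strict Implicit.
Unset Printing Implicit Defensive.

Import Order.TTheory GRing.Theory Num.Theory.
Import numFieldNormedType.Exports.

Local Open Scope classical_set_scope.
Local Open Scope ring_scope.

(** The slope of the cut would be a subgradient of the value function if it were
    computed from an exact primal solution [y0] and exact dual multipliers
    [(lam, mu)] at [xbar]. Indeed the Lagrangian [f + lam . (A y + B x - b) +
    mu . g] is jointly convex, hence above its tangent at [(y0, xbar)]; [y0]
    minimises it over [Y] at [xbar], so that its derivative in the direction of
    any other point of [Y] is nonnegative, and on feasible pairs it is at most
    [f] ([lagrangian_subgradient]). The correction [eta] pays for replacing the
    exact solutions by the approximate ones: strong convexity of the objective
    and strong concavity of the dual function ([strongly_concave_near_max]) place
    the latter at distance [O(sqrt eps)] from the former, and the Lipschitz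
    constants of the gradients, the norm of [B^T] and Slater's bound on [mu]
    ([multiplier_sum_le]) turn these distances into a bound on the change of
    slope ([slope_perturbation]).

    What makes exact multipliers available is strong duality with dual
    attainment ([lagrange_multipliers]). It is obtained by dualising the
    constraints one at a time: for a single function [h] taking both signs on a
    convex set, a multiplier is any number separating the slopes [- phi / h] over
    [h > 0] from those over [h < 0] ([slope_separation]), so that a supremum in
    the real line replaces the separation of convex sets. Slater's condition
    provides the point with [h < 0] for an inequality; for an equation, a point of
    the relative interior on the hyperplane [h = 0] provides both signs. When [Y]
    is a polyhedron and the Slater point may be on its relative boundary, the
    function left after dualising the inequalities is replaced by its tangent at
    [y0], and Farkas' lemma ([farkas]) gives the multipliers of the equations. *)

(** * Euclidean norm *)

Section euclidean_space.
Context {R : realType}.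

Lemma dotpE n (u v : 'cV[R]_n) : dotp u v = \sum_i u i ord0 * v i ord0.
Proof. by rewrite /dotp mxE; apply: eq_bigr => i _; rewrite mxE. Qed.

Lemma dotpC n (u v : 'cV[R]_n) : dotp u v = dotp v u.
Proof. by rewrite !dotpE; apply: eq_bigr => i _; rewrite mulrC. Qed.

Lemma dotpDl n (u v w : 'cV[R]_n) : dotp (u + v) w = dotp u w + dotp v w.
Proof. by rewrite /dotp linearD mulmxDl mxE. Qed.

Lemma dotpNl n (u w : 'cV[R]_n) : dotp (- u) w = - dotp u w.
Proof. by rewrite /dotp linearN mulNmx mxE. Qed.

Lemma dotpBl n (u v w : 'cV[R]_n) : dotp (u - v) w = dotp u w - dotp v w.
Proof. by rewrite dotpDl dotpNl. Qed.

Lemma dotpZl n k (u w : 'cV[R]_n) : dotp (k *: u) w = k * dotp u w.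
Proof. by rewrite /dotp linearZ -scalemxAl mxE. Qed.

Lemma dotpBr n (u v w : 'cV[R]_n) : dotp w (u - v) = dotp w u - dotp w v.
Proof. by rewrite !(dotpC w) dotpBl. Qed.

Lemma dotpZr n k (u w : 'cV[R]_n) : dotp w (k *: u) = k * dotp w u.
Proof. by rewrite !(dotpC w) dotpZl. Qed.

Lemma dotp0l n (w : 'cV[R]_n) : dotp 0 w = 0.
Proof. by rewrite dotpE big1 // => i _; rewrite mxE mul0r. Qed.

Lemma dotp_suml n I (r : seq I) (P : pred I) (F : I -> 'cV[R]_n) w :
  dotp (\sum_(i <- r | P i) F i) w = \sum_(i <- r | P i) dotp (F i) w.
Proof.
elim/big_rec2: _ => [|i a u _ <-]; first exact: dotp0l.
exact: dotpDl.
Qed.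

Lemma dotp_lincomb n p (a : 'I_p -> R) (F : 'I_p -> 'cV[R]_n) w :
  dotp (\sum_i a i *: F i) w = \sum_i a i * dotp (F i) w.
Proof. by rewrite dotp_suml; apply: eq_bigr => i _; rewrite dotpZl. Qed.

Lemma dotp_trmx m n (M : 'M[R]_(m, n)) (u : 'cV[R]_m) (v : 'cV[R]_n) :
  dotp (M^T *m u) v = dotp u (M *m v).
Proof. by rewrite /dotp trmx_mul trmxK mulmxA. Qed.

Lemma dotp_ge0 n (u : 'cV[R]_n) : 0 <= dotp u u.
Proof. by rewrite dotpE sumr_ge0 // => i _; rewrite -expr2 sqr_ge0. Qed.

Lemma norm2_ge0 n (u : 'cV[R]_n) : 0 <= norm2 u.
Proof. exact: sqrtr_ge0. Qed.

Lemma norm2_sqr n (u : 'cV[R]_n) : norm2 u ^+ 2 = dotp u u.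
Proof. by rewrite sqr_sqrtr // dotp_ge0. Qed.

Lemma norm2N n (u : 'cV[R]_n) : norm2 (- u) = norm2 u.
Proof. by rewrite /norm2 dotpNl dotpC dotpNl opprK. Qed.

Lemma norm2Z n k (u : 'cV[R]_n) : norm2 (k *: u) = `|k| * norm2 u.
Proof.
by rewrite /norm2 dotpZl dotpZr mulrA -expr2 sqrtrM ?sqr_ge0 // sqrtr_sqr.
Qed.

Lemma norm2_eq0 n (u : 'cV[R]_n) : norm2 u = 0 -> u = 0.
Proof.
move=> u0; have : dotp u u = 0 by rewrite -norm2_sqr u0 expr0n.
rewrite dotpE => /psumr_eq0P ui0; apply/matrixP => i j.
rewrite ord1 mxE; apply/eqP.
have /eqP := ui0 (fun k _ => sqr_ge0 (u k ord0)) i isT.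
by rewrite mulf_eq0 orbb.
Qed.

Lemma dotp_le_norm2 n (u v : 'cV[R]_n) : dotp u v <= norm2 u * norm2 v.
Proof.
have [u0|u0] := eqVneq (norm2 u) 0.
  by rewrite (norm2_eq0 u0) dotp0l mulr_ge0 ?norm2_ge0.
have {u0}u0 : 0 < norm2 u by rewrite lt_def u0 norm2_ge0.
have [v0|v0] := eqVneq (norm2 v) 0.
  by rewrite (norm2_eq0 v0) dotpC dotp0l mulr_ge0 ?norm2_ge0.
have {v0}v0 : 0 < norm2 v by rewrite lt_def v0 norm2_ge0.
have := dotp_ge0 (norm2 v *: u - norm2 u *: v).
rewrite dotpBl !dotpBr !dotpZl !dotpZr -!norm2_sqr (dotpC v u).
have -> a b c : a * (a * b ^+ 2) - a * (b * c) - (b * (a * c) - b * (b * a ^+ 2))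
  = 2 * (b * a) * (b * a - c) :> R by ring.
by rewrite pmulr_rge0 ?mulr_gt0 // subr_ge0.
Qed.

Lemma ler_norm2_sqr n (u : 'cV[R]_n) a :
  0 <= a -> (norm2 u <= a) = (norm2 u ^+ 2 <= a ^+ 2).
Proof. by move=> a0; rewrite ler_pXn2r // nnegrE norm2_ge0. Qed.

(** The Frobenius bound, a crude estimate whose only purpose is to show that the
    supremum defining the operator norm is finite. *)
Lemma norm2_mulmx_le m n (M : 'M[R]_(m, n)) (u : 'cV[R]_n) :
  norm2 (M *m u) <= Num.sqrt (\sum_i norm2 (row i M)^T ^+ 2) * norm2 u.
Proof.
rewrite ler_norm2_sqr ?mulr_ge0 ?norm2_ge0 ?sqrtr_ge0 //.
rewrite exprMn [X in _ <= X * _]sqr_sqrtr; last first.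
  by apply: sumr_ge0 => i _; rewrite sqr_ge0.
rewrite norm2_sqr dotpE mulr_suml; apply: ler_sum => i _.
have Mui : (M *m u) i ord0 = dotp (row i M)^T u.
  by rewrite dotpE mxE; apply: eq_bigr => j _; rewrite !mxE.
rewrite -expr2 -exprMn -real_normK ?num_real // ler_pXn2r ?nnegrE //; last first.
  by rewrite mulr_ge0 ?norm2_ge0.
rewrite Mui ler_norml dotp_le_norm2 andbT lerNl -dotpNl -norm2N.
exact: dotp_le_norm2.
Qed.

Lemma norm2_le_opnorm2 m n (M : 'M[R]_(m, n)) (u : 'cV[R]_n) :
  norm2 (M *m u) <= opnorm2 M * norm2 u.
Proof.
have Mub : has_ubound [set norm2 (M *m u) | u in [set u | norm2 u <= 1]].
  exists (Num.sqrt (\sum_i norm2 (row i M)^T ^+ 2)) => _ [v /= v1 <-].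
  apply: (le_trans (norm2_mulmx_le _ _)).
  by rewrite -[leRHS]mulr1 ler_wpM2l // sqrtr_ge0.
have [u0|u0] := eqVneq (norm2 u) 0.
  by rewrite (norm2_eq0 u0) mulmx0 /norm2 !dotp0l sqrtr0 mulr0.
have u0' : 0 < norm2 u by rewrite lt_def u0 norm2_ge0.
rewrite -ler_pdivrMr // mulrC.
apply: (le_trans _ (ub_le_sup Mub _)); last first.
  exists ((norm2 u)^-1 *: u); last reflexivity.
  by rewrite /= norm2Z normfV ger0_norm ?norm2_ge0 // mulVf.
by rewrite -scalemxAr norm2Z normfV ger0_norm ?norm2_ge0.
Qed.

Lemma norm2_le_mx_norm n (u : 'cV[R]_n) : norm2 u <= Num.sqrt n%:R * `|u|.
Proof.
rewrite ler_norm2_sqr ?mulr_ge0 ?sqrtr_ge0 // norm2_sqr exprMn sqr_sqrtr ?ler0n //.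
rewrite dotpE mulrC mulr_natr.
have -> : `|u| ^+ 2 *+ n = \sum_(i < n) `|u| ^+ 2.
  by rewrite sumr_const card_ord.
apply: ler_sum => i _.
rewrite -expr2 -real_normK ?num_real // ler_pXn2r ?nnegrE //.
rewrite [`|u|]/Num.Def.normr /= mx_normrE.
exact: (le_bigmax _ (fun ij => `|u ij.1 ij.2|) (i, ord0)).
Qed.

Lemma norm2_le_diam2 n (X : set 'cV[R]_n) x y :
  compact X -> X x -> X y -> norm2 (x - y) <= diam2 X.
Proof.
move=> /compact_bounded[M [_ MX]] Xx Xy.
apply: ub_le_sup; last by exists (x, y).
exists (Num.sqrt n%:R * ((M + 1) + (M + 1))) => _ [[u v] [/= Xu Xv] <-].
apply: (le_trans (norm2_le_mx_norm _)); rewrite ler_wpM2l ?sqrtr_ge0 //.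
apply: (le_trans (ler_normB _ _)).
by apply: lerD; apply: MX => //; rewrite ltrDl.
Qed.

Lemma norm1_le_norm2 n (u : 'cV[R]_n) :
  \sum_i `|u i ord0| <= Num.sqrt n%:R * norm2 u.
Proof.
have := dotp_le_norm2 (const_mx 1) (map_mx Num.norm u).
rewrite dotpE; under eq_bigr do rewrite !mxE mul1r.
move=> /le_trans; apply; rewrite le_eqVlt; apply/orP; left; apply/eqP.
congr (_ * _); rewrite /norm2; congr Num.sqrt; rewrite !dotpE.
  by under eq_bigr do rewrite !mxE mulr1; rewrite sumr_const card_ord.
by apply: eq_bigr => i _; rewrite !mxE -normrM -expr2 ger0_norm ?sqr_ge0.
Qed.

Lemma norm2_pair_sqr q p (z : 'cV[R]_q * 'cV[R]_p) :
  norm2_pair z ^+ 2 = norm2 z.1 ^+ 2 + norm2 z.2 ^+ 2.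
Proof.
rewrite /norm2_pair !norm2_sqr !dotpE big_split_ord /=.
by congr (_ + _); apply: eq_bigr => i _; rewrite ?col_mxEu ?col_mxEd.
Qed.

(** The constant comes from [(a + b)^2 <= 2 (a^2 + b^2)]. *)
Lemma norm2_add_le_pair q p (z : 'cV[R]_q * 'cV[R]_p) :
  norm2 z.1 + norm2 z.2 <= Num.sqrt 2 * norm2_pair z.
Proof.
rewrite -(@ler_pXn2r _ 2) ?nnegrE ?addr_ge0 ?mulr_ge0 ?norm2_ge0 ?sqrtr_ge0 //.
rewrite exprMn sqr_sqrtr ?ler0n // norm2_pair_sqr -subr_ge0.
have -> a b : 2 * (a ^+ 2 + b ^+ 2) - (a + b) ^+ 2 = (a - b) ^+ 2 :> R by ring.
exact: sqr_ge0.
Qed.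

End euclidean_space.

(** * Lagrange multipliers on a convex set *)

Section multipliers.
Context {R : realType} {V : lmodType R}.
Implicit Types (S : set V) (h phi : V -> R).

Definition convex_dom S := forall x y (t : R),
  S x -> S y -> 0 <= t <= 1 -> S (t *: x + (1 - t) *: y).

Definition convex_fun S h := forall x y (t : R), S x -> S y -> 0 <= t <= 1 ->
  h (t *: x + (1 - t) *: y) <= t * h x + (1 - t) * h y.

Definition affine_fun h := forall x y (t : R),
  h (t *: x + (1 - t) *: y) = t * h x + (1 - t) * h y.

(** The algebraic counterpart of a relative interior point: every segment of [S]
    ending at [z] can be prolonged beyond [z]. Unlike the relative interior, it
    is stated without a topology, and it passes at once to the sections of [S] by
    hyperplanes through [z]. *)
Definition core_point S z :=
  S z /\ forall y, S y -> exists2 t : R, 1 < t & S (t *: z + (1 - t) *: y).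

Lemma convex_comb_id (x : V) (t : R) : t *: x + (1 - t) *: x = x.
Proof. by rewrite -scalerDl addrC subrK scale1r. Qed.

Lemma segmentE (x y : V) (t : R) : x + t *: (y - x) = t *: y + (1 - t) *: x.
Proof. by rewrite scalerBl scale1r scalerBr addrCA. Qed.

Lemma affine_convex_fun S h : affine_fun h -> convex_fun S h.
Proof. by move=> ah x y t _ _ _; rewrite ah. Qed.

Lemma convex_funD S h1 h2 : convex_fun S h1 -> convex_fun S h2 ->
  convex_fun S (fun y => h1 y + h2 y).
Proof.
move=> c1 c2 x y t Sx Sy t01.
by have := lerD (c1 x y t Sx Sy t01) (c2 x y t Sx Sy t01); nra.
Qed.

Lemma convex_funZ S h (k : R) : 0 <= k -> convex_fun S h ->
  convex_fun S (fun y => k * h y).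
Proof.
move=> k0 ch x y t Sx Sy t01.
by have := ler_wpM2l k0 (ch x y t Sx Sy t01); nra.
Qed.

Lemma convex_fun_sum S I (r : seq I) (h : I -> V -> R) :
  (forall i, convex_fun S (h i)) -> convex_fun S (fun y => \sum_(i <- r) h i y).
Proof.
move=> ch x y t Sx Sy t01; rewrite !mulr_sumr -big_split /=.
by apply: ler_sum => i _; exact: ch.
Qed.

Lemma convex_funS S T h : S `<=` T -> convex_fun T h -> convex_fun S h.
Proof. by move=> ST ch x y t /ST Tx /ST Ty; exact: ch. Qed.

Lemma convex_dom_sublevel S h :
  convex_dom S -> convex_fun S h -> convex_dom [set y | S y /\ h y <= 0].
Proof.
move=> cS ch x y t [Sx hx] [Sy hy] t01; split; first exact: cS.
by apply: (le_trans (ch _ _ _ Sx Sy t01)); nra.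
Qed.

Lemma convex_dom_level S h :
  convex_dom S -> affine_fun h -> convex_dom [set y | S y /\ h y = 0].
Proof.
move=> cS ah x y t [Sx hx] [Sy hy] t01; split; first exact: cS.
by rewrite ah hx hy !mulr0 addr0.
Qed.

(** When [h] changes sign, [mu] is a multiplier as soon as it lies above all the
    slopes [- phi / h] on [h > 0] and below all those on [h < 0]; the cross
    inequality says exactly that the first ones are below the second ones, so
    that a supremum does it. *)
Lemma slope_separation S phi h :
  (forall y, S y -> h y = 0 -> 0 <= phi y) ->
  (forall y z, S y -> S z -> 0 < h y -> h z < 0 ->
     0 <= h y * phi z - h z * phi y) ->
  (exists2 y, S y & 0 < h y) -> (exists2 z, S z & h z < 0) ->
  exists mu : R, forall y, S y -> 0 <= phi y + mu * h y.
Proof.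
move=> h0 cross [y0 Sy0 hy0] [z0 Sz0 hz0].
pose E := [set - phi y / h y | y in [set y | S y /\ 0 < h y]].
have slope y z : S y -> S z -> 0 < h y -> h z < 0 ->
    - phi y / h y <= phi z / - h z.
  move=> Sy Sz hy hz; rewrite ler_pdivrMr // mulrAC ler_pdivlMr ?oppr_gt0 //.
  by have := cross y z Sy Sz hy hz; nra.
have supE : has_sup E.
  split; first by exists (- phi y0 / h y0), y0.
  by exists (phi z0 / - h z0) => _ [y [Sy hy] <-]; exact: slope.
exists (sup E) => y Sy; have [hy|hy|hy] := ltgtP (h y) 0.
- have : sup E <= phi y / - h y.
    by apply: ge_sup; [case: supE|move=> _ [x [Sx hx] <-]; exact: slope].
  by rewrite ler_pdivlMr ?oppr_gt0 //; nra.
- have : - phi y / h y <= sup E by apply: ub_le_sup; [case: supE|exists y].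
  by rewrite ler_pdivrMr //; nra.
- by rewrite hy mulr0 addr0 h0.
Qed.

(** Normalised, [h y] and [- h z] are the weights for which the combination of
    [h z] and [h y] vanishes; the conclusion is the convexity inequality of [phi]
    for these weights, cleared of denominators. *)
Lemma cross_inequality S phi h y z : convex_fun S phi ->
  (forall t, 0 <= t <= 1 -> t * h z + (1 - t) * h y = 0 ->
     0 <= phi (t *: z + (1 - t) *: y)) ->
  S y -> S z -> 0 < h y -> h z < 0 -> 0 <= h y * phi z - h z * phi y.
Proof.
move=> cphi pos Sy Sz hy hz.
have d0 : 0 < h y - h z by rewrite subr_gt0 (lt_trans hz).
pose t := h y / (h y - h z).
have t01 : 0 <= t <= 1.
  by rewrite divr_ge0 ?(ltW hy) ?(ltW d0) //= ler_pdivrMr // mul1r; lra.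
have tE : 1 - t = - h z / (h y - h z) by rewrite /t; field; rewrite gt_eqF.
have := le_trans (pos t t01 _) (cphi _ _ _ Sz Sy t01).
have -> : t * phi z + (1 - t) * phi y =
    (h y * phi z - h z * phi y) / (h y - h z).
  by rewrite tE /t; field; rewrite gt_eqF.
rewrite pmulr_lge0 ?invr_gt0 //; apply.
by rewrite tE /t; field; rewrite gt_eqF.
Qed.

(** The separating slope may come out negative; the value [0] then works too,
    since [phi] is nonnegative where [h <= 0] and, elsewhere, a negative multiple
    of [h] could only decrease [phi]. *)
Lemma inequality_multiplier S phi h z : convex_dom S -> convex_fun S phi ->
  convex_fun S h -> S z -> h z < 0 ->
  (forall y, S y -> h y <= 0 -> 0 <= phi y) ->
  exists2 mu : R, 0 <= mu & forall y, S y -> 0 <= phi y + mu * h y.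
Proof.
move=> cS cphi ch Sz hz pos.
have [[y0 Sy0 hy0]|no] := pselect (exists2 y, S y & 0 < h y); last first.
  exists 0 => // y Sy; rewrite mul0r addr0 pos // leNgt; apply/negP => hy.
  by apply: no; exists y.
have [||||mu mupos] := @slope_separation S phi h.
- by move=> y Sy hy; rewrite pos // hy.
- move=> x y Sx Sy hx hy; apply: (@cross_inequality S) => // t t01 t0.
  by apply: pos; [exact: cS|rewrite -t0; exact: ch].
- by exists y0.
- by exists z.
exists (Num.max mu 0); first by rewrite le_max lexx orbT.
move=> y Sy; have [muge|mult] := leP 0 mu; first exact: mupos.
rewrite mul0r addr0; have [hy|hy] := leP (h y) 0; first exact: pos.
by have := mupos y Sy; nra.
Qed.

(** Slater's condition yields multipliers for finitely many convex inequalities: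
    the constraints are dualised one at a time, the remaining ones being moved
    into the convex set. *)
Lemma inequality_multipliers p (h : 'I_p -> V -> R) S phi z :
  convex_dom S -> convex_fun S phi -> (forall i, convex_fun S (h i)) ->
  S z -> (forall i, h i z < 0) ->
  (forall y, S y -> (forall i, h i y <= 0) -> 0 <= phi y) ->
  exists2 mu : 'I_p -> R, (forall i, 0 <= mu i) &
    forall y, S y -> 0 <= phi y + \sum_i mu i * h i y.
Proof.
elim: p h S phi => [|p IH] h S phi cS cphi ch Sz hz pos.
  exists (fun=> 0) => // y Sy; rewrite big_ord0 addr0 pos //.
  by case.
pose S' := [set y | S y /\ h ord0 y <= 0].
have S'S : S' `<=` S by move=> y [].
have [|||||y [Sy hy0] hy|mu mu0 mupos] := IH (fun i => h (lift ord0 i)) S' phi.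
- exact: convex_dom_sublevel.
- exact: convex_funS cphi.
- by move=> i; exact: convex_funS (ch _).
- by split=> //; exact: ltW.
- by [].
- apply: pos => // i; have [j ->|->//] := unliftP ord0 i.
  exact: hy.
have [||||y Sy hy|nu nu0 nupos] := @inequality_multiplier S
    (fun y => phi y + \sum_i mu i * h (lift ord0 i) y) (h ord0) z cS.
- by apply: convex_funD => //; apply: convex_fun_sum => i; exact: convex_funZ.
- exact: ch.
- exact: Sz.
- exact: hz.
- exact: mupos.
exists (fun i => oapp mu nu (unlift ord0 i)).
  by move=> i; case: (unlift ord0 i).
move=> y Sy; rewrite big_ord_recl unlift_none /=.
under eq_bigr do rewrite liftK /=.
by rewrite addrCA addrC; exact: nupos.
Qed.

Lemma core_point_level S h z : affine_fun h -> h z = 0 -> core_point S z ->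
  core_point [set y | S y /\ h y = 0] z.
Proof.
move=> ah hz [Sz zcore]; split => // y [Sy hy].
have [t t1 St] := zcore y Sy; exists t => //; split => //.
by rewrite ah hz hy !mulr0 addr0.
Qed.

(** A core point on the hyperplane [h = 0] forces [h] either to vanish on [S] or
    to change sign there, which is what the separation of slopes needs. *)
Lemma equality_multiplier S phi h z : convex_dom S -> convex_fun S phi ->
  affine_fun h -> core_point S z -> h z = 0 ->
  (forall y, S y -> h y = 0 -> 0 <= phi y) ->
  exists mu : R, forall y, S y -> 0 <= phi y + mu * h y.
Proof.
move=> cS cphi ah [Sz zcore] hz pos.
have [[y0 Sy0 hy0]|no] := pselect (exists2 y, S y & h y != 0); last first.
  exists 0 => y Sy; rewrite mul0r addr0 pos //; apply/eqP/negPn/negP => hy.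
  by apply: no; exists y.
have [t t1 St] := zcore y0 Sy0.
have ht : h (t *: z + (1 - t) *: y0) = (1 - t) * h y0.
  by rewrite ah hz mulr0 add0r.
apply: slope_separation => //.
- move=> y x Sy Sx hy hx; apply: (@cross_inequality S) => //.
  by move=> s s01 s0; apply: pos; [exact: cS|rewrite ah].
- have [y0pos|y0neg|/eqP] := ltgtP (h y0) 0.
  + by exists (t *: z + (1 - t) *: y0) => //; rewrite ht nmulr_rgt0 // subr_lt0.
  + by exists y0.
  + by rewrite (negPf hy0).
- have [y0pos|y0neg|/eqP] := ltgtP (h y0) 0.
  + by exists y0.
  + by exists (t *: z + (1 - t) *: y0) => //; rewrite ht nmulr_rlt0 // subr_lt0.
  + by rewrite (negPf hy0).
Qed.

(** Same elimination as for inequalities: [z] remains a core point of the section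
    by the equations not yet dualised. *)
Lemma equality_multipliers q (h : 'I_q -> V -> R) S phi z :
  convex_dom S -> convex_fun S phi -> (forall i, affine_fun (h i)) ->
  core_point S z -> (forall i, h i z = 0) ->
  (forall y, S y -> (forall i, h i y = 0) -> 0 <= phi y) ->
  exists mu : 'I_q -> R, forall y, S y -> 0 <= phi y + \sum_i mu i * h i y.
Proof.
elim: q h S phi => [|q IH] h S phi cS cphi ah zcore hz pos.
  exists (fun=> 0) => // y Sy; rewrite big_ord0 addr0 pos //.
  by case.
pose S' := [set y | S y /\ h ord0 y = 0].
have S'S : S' `<=` S by move=> y [].
have [|||||y [Sy hy0] hy|mu mupos] := IH (fun i => h (lift ord0 i)) S' phi.
- exact: convex_dom_level.
- exact: convex_funS cphi.
- by move=> i; exact: ah.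
- exact: core_point_level.
- by [].
- apply: pos => // i; have [j ->|->//] := unliftP ord0 i.
  exact: hy.
have [||||y Sy hy|nu nupos] := @equality_multiplier S
    (fun y => phi y + \sum_i mu i * h (lift ord0 i) y) (h ord0) z cS.
- apply: convex_funD => //; apply: convex_fun_sum => i.
  by apply: affine_convex_fun => x y t; rewrite ah; ring.
- exact: ah.
- exact: zcore.
- exact: hz.
- exact: mupos.
exists (fun i => oapp mu nu (unlift ord0 i)).
move=> y Sy; rewrite big_ord_recl unlift_none /=.
under eq_bigr do rewrite liftK /=.
by rewrite addrCA addrC; exact: nupos.
Qed.

End multipliers.

(** * Farkas' lemma and polyhedral multipliers *)

Section farkas.
Context {R : realType}.

(** Farkas' lemma, by Bartl's induction on the number of functionals. If the
    first functional [a0] cannot be dropped, there is [x] in the cone of the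
    others with [dotp c x > 0], hence with [dotp a0 x > 0]; projecting along [x]
    onto the kernel of [a0] removes [a0] from the system, and the signs at [x]
    make the coefficient of [a0] nonnegative when going back. *)
Lemma farkas n k (a : 'I_k -> 'cV[R]_n) (c : 'cV[R]_n) :
  (forall x, (forall i, dotp (a i) x <= 0) -> dotp c x <= 0) ->
  exists2 u : 'I_k -> R, (forall i, 0 <= u i) & c = \sum_i u i *: a i.
Proof.
elim: k a c => [|k IH] a c hac.
  exists (fun=> 0) => //; rewrite big_ord0; apply: norm2_eq0.
  have : dotp c c <= 0 by apply: hac; case.
  by rewrite /norm2 => /ler0_sqrtr.
have [drop|] := pselect (forall x,
    (forall i, dotp (a (lift ord0 i)) x <= 0) -> dotp c x <= 0).
  have [u u0 ->] := IH _ _ drop.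
  exists (fun i => oapp u 0 (unlift ord0 i)).
    by move=> i; case: (unlift ord0 i).
  rewrite big_ord_recl unlift_none /= scale0r add0r.
  by apply: eq_bigr => i _; rewrite liftK.
move=> /existsNP[x0 /not_implyP[ax0 /negP]]; rewrite -ltNge => cx0.
set a0 := a ord0.
have a0x0 : 0 < dotp a0 x0.
  rewrite ltNge; apply/negP => a0x0; have : dotp c x0 <= 0; last by lra.
  by apply: hac => i; have [j ->|->//] := unliftP ord0 i; exact: ax0.
pose x := (dotp a0 x0)^-1 *: x0.
have a0x : dotp a0 x = 1 by rewrite dotpZr mulVf // gt_eqF.
have ax i : dotp (a (lift ord0 i)) x <= 0.
  by rewrite dotpZr pmulr_rle0 ?invr_gt0.
have cx : 0 < dotp c x by rewrite dotpZr mulr_gt0 ?invr_gt0.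
clearbody x.
pose proj v := v - dotp v x *: a0.
have projE v y : dotp (proj v) y = dotp v (y - dotp a0 y *: x).
  by rewrite dotpBl dotpZl dotpBr dotpZr mulrC.
have [y ay|u u0 cE] := IH (fun i => proj (a (lift ord0 i))) (proj c).
  rewrite projE; apply: hac => i; have [j ->|->] := unliftP ord0 i.
    by rewrite -projE; exact: ay.
  by rewrite -/a0 dotpBr dotpZr a0x mulr1 subrr.
pose s := dotp c x - \sum_j u j * dotp (a (lift ord0 j)) x.
have s0 : 0 <= s.
  rewrite subr_ge0; apply: (le_trans _ (ltW cx)).
  by rewrite -oppr_ge0 -sumrN sumr_ge0 // => j _; rewrite oppr_ge0 mulr_ge0_le0.
exists (fun i => oapp u s (unlift ord0 i)); first by move=> i; case: unlift.
rewrite big_ord_recl unlift_none /=; under eq_bigr do rewrite liftK /=.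
have -> : c = proj c + dotp c x *: a0 by rewrite subrK.
rewrite cE /s scalerBl scaler_suml -/a0.
have -> : \sum_i u i *: proj (a (lift ord0 i)) =
    \sum_i u i *: a (lift ord0 i)
    - \sum_i (u i * dotp (a (lift ord0 i)) x) *: a0.
  by rewrite -sumrB; apply: eq_bigr => i _; rewrite scalerBr scalerA.
by rewrite addrC addrA addrAC.
Qed.

Lemma farkas_mx n k (M : 'M[R]_(k, n)) (c : 'cV[R]_n) :
  (forall x, (forall i, (M *m x) i ord0 <= 0) -> dotp c x <= 0) ->
  exists2 u : 'cV[R]_k, (forall i, 0 <= u i ord0) & c = M^T *m u.
Proof.
have rowE x i : dotp (row i M)^T x = (M *m x) i ord0.
  by rewrite dotpE mxE; apply: eq_bigr => j _; rewrite !mxE.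
move=> hMc; have [x xM|u u0 cE] := @farkas n k (fun i => (row i M)^T) c.
  by apply: hMc => i; rewrite -rowE.
exists (\col_i u i); first by move=> i; rewrite mxE.
rewrite cE; apply/matrixP => i j; rewrite summxE mxE.
by apply: eq_bigr => l _; rewrite !mxE mulrC.
Qed.

Lemma dotp_col_mx p q (u v : 'cV[R]_p) (u' v' : 'cV[R]_q) :
  dotp (col_mx u u') (col_mx v v') = dotp u v + dotp u' v'.
Proof.
rewrite !dotpE big_split_ord /=.
by congr (_ + _); apply: eq_bigr => i _; rewrite ?col_mxEu ?col_mxEd.
Qed.

(** A direction that does not increase the tight constraints is feasible: the
    slack ones bound the step, and there are finitely many of them. *)
Lemma small_step k (s w : 'I_k -> R) : (forall i, 0 < s i \/ 0 <= s i /\ w i <= 0) ->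
  exists2 t : R, 0 < t & forall i, t * w i <= s i.
Proof.
move=> sw; pose r i := if 0 < s i then s i / (`|w i| + 1) else 1.
have w1 i : 0 < `|w i| + 1 by rewrite ltr_wpDl.
have r0 i : 0 < r i by rewrite /r; case: ifP => // si; rewrite divr_gt0.
exists (\big[Num.min/1]_i r i); first exact: lt_bigmin.
set t := \big[_/_]_i _ => i.
have t0 : 0 < t by apply: lt_bigmin.
have tr : t <= r i by exact: bigmin_le.
case: (sw i) => [si|[si wi]]; last first.
  by apply: (le_trans _ si); rewrite pmulr_rle0.
move: tr; rewrite /r si ler_pdivlMr // => tr; apply: (le_trans _ tr).
by rewrite ler_pM2l // (le_trans (ler_norm _)) // lerDl.
Qed.

(** Near [y0] a polyhedron coincides with its tangent cone, which the active
    inequalities cut out; Farkas' lemma applies to this cone. *)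
Lemma polyhedral_multipliers n k q (C : 'M[R]_(k, n)) (d : 'cV[R]_k)
    (A : 'M[R]_(q, n)) (c y0 : 'cV[R]_n) :
  let P := [set y | forall i, (C *m y) i ord0 <= d i ord0] in
  P y0 -> (forall y, P y -> A *m y = A *m y0 -> 0 <= dotp c (y - y0)) ->
  exists lam : 'cV[R]_q, forall y, P y ->
    0 <= dotp c (y - y0) + dotp lam (A *m (y - y0)).
Proof.
move=> P Py0 min0.
(* The inactive rows are zeroed, which drops them from the cone. *)
pose C' := \matrix_(i, j) (if (C *m y0) i ord0 == d i ord0 then C i j else 0).
have C'E w i : (C' *m w) i ord0 =
    if (C *m y0) i ord0 == d i ord0 then (C *m w) i ord0 else 0.
  rewrite mxE; case: ifP => act; last first.
    by rewrite big1 // => j _; rewrite mxE act mul0r.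
  by rewrite mxE; apply: eq_bigr => j _; rewrite mxE act.
have [w Mw|u u0 cE] := @farkas_mx n _ (col_mx C' (col_mx A (- A))) (- c).
  have C'w i : (C' *m w) i ord0 <= 0.
    by have := Mw (lshift _ i); rewrite mul_col_mx col_mxEu.
  have Aw : A *m w = 0.
    apply/matrixP => i j; rewrite ord1 [RHS]mxE; apply/eqP; rewrite eq_le.
    have := Mw (rshift _ (lshift _ i)).
    have := Mw (rshift _ (rshift _ i)).
    rewrite !mul_col_mx !col_mxEd col_mxEu.
    have -> : (- A *m w) i ord0 = - (A *m w) i ord0 by rewrite mulNmx mxE.
    by rewrite oppr_le0 => -> ->.
  have [i|t t0 tP] := @small_step k
      (fun i => d i ord0 - (C *m y0) i ord0) (fun i => (C *m w) i ord0).
    rewrite subr_gt0 subr_ge0 lt_def Py0 andbT.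
    have := C'w i; rewrite C'E eq_sym; case: eqP => /= act; last by left.
    by right.
  have : 0 <= dotp c (y0 + t *: w - y0).
    apply: min0 => [i|]; last by rewrite mulmxDr -scalemxAr Aw scaler0 addr0.
    by have := tP i; rewrite mulmxDr -scalemxAr !mxE; lra.
  by rewrite addrAC subrr add0r dotpZr dotpNl oppr_le0 pmulr_rge0.
move: u0 cE; rewrite -[u]vsubmxK -[dsubmx u]vsubmxK.
set u1 := usubmx _; set u2 := usubmx _; set u3 := dsubmx _ => u0 cE.
exists (u2 - u3) => y Py.
have -> : dotp c (y - y0) = - (dotp u1 (C' *m (y - y0))
    + (dotp u2 (A *m (y - y0)) - dotp u3 (A *m (y - y0)))).
  rewrite -[c]opprK dotpNl cE dotp_trmx !mul_col_mx !dotp_col_mx mulNmx.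
  by rewrite [dotp _ (- _)]dotpC dotpNl (dotpC _ u3).
rewrite dotpBl.
have -> (r s t : R) : - (r + (s - t)) + (s - t) = - r by ring.
rewrite oppr_ge0 dotpE sumr_le0 // => i _; rewrite mulr_ge0_le0 //.
  by have := u0 (lshift _ i); rewrite col_mxEu.
rewrite C'E; case: eqP => // act.
by have := Py i; rewrite mulmxBr !mxE -act mxE; lra.
Qed.

End farkas.

(** * Directional derivatives and gradients *)

Section directional_derivatives.
Context {R : realType}.

Section normed.
Context {V : normedModType R}.
Implicit Types (h : V -> R^o).

(** One-sided control of the increments suffices, since the derivative, being a
    two-sided limit, is also the limit from the right. *)
Lemma derive_le h (z u : V) (c d : R) : differentiable h z -> 0 < d ->
  (forall t, 0 < t -> t <= d -> h (z + t *: u) <= h z + t * c) ->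
  'D_u h z <= c.
Proof.
move=> dh d0 hle.
have /cvg_dnbhs_at_right hcvg := diff_derivable (v := u) dh.
apply: (cvgr_to_le hcvg); near=> t.
have t0 : 0 < t by near: t; exact: nbhs_right_gt.
have td : t <= d by near: t; exact: nbhs_right_le.
rewrite [X in _ <= X](_ : c = t^-1 *: (t * c : R^o)); last first.
  by rewrite -[RHS]/(t^-1 * (t * c)) mulKf ?gt_eqF.
rewrite ler_pM2l ?invr_gt0 // lerBlDl /= [_ *: u + z]addrC.
exact: hle.
Unshelve. all: by end_near. Qed.

Lemma derive_ge h (z u : V) (c d : R) : differentiable h z -> 0 < d ->
  (forall t, 0 < t -> t <= d -> h z + t * c <= h (z + t *: u)) ->
  c <= 'D_u h z.
Proof.
move=> dh d0 hge; rewrite -lerN2 -deriveN; last exact: diff_derivable.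
apply: (derive_le _ d0) => [|t t0 td]; first exact: differentiableN.
by rewrite mulrN -[(- h) _]/(- h _) -[(- h) z]/(- h z) -opprD lerN2 hge.
Qed.

Lemma deriveDdir h (z u v : V) : differentiable h z ->
  'D_(u + v) h z = 'D_u h z + 'D_v h z.
Proof. by move=> dh; rewrite !deriveE // linearD. Qed.

Lemma convex_fun_ge_tangent S h (z z' : V) : convex_fun S h ->
  S z -> S z' -> differentiable h z -> h z + 'D_(z' - z) h z <= h z'.
Proof.
move=> ch Sz Sz' dh; rewrite -lerBrDl.
apply: (derive_le dh ltr01) => t t0 t1.
have := ch z' z t Sz' Sz; rewrite (ltW t0) t1 => /(_ isT).
rewrite -segmentE.
by move=> /le_trans; apply; lra.
Qed.

Lemma differentiable_lincomb p h (g : 'I_p -> V -> R^o) (mu : 'I_p -> R) z :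
  differentiable h z -> (forall i, differentiable (g i) z) ->
  differentiable (fun x => h x + \sum_i mu i * g i x : R^o) z.
Proof.
move=> dh dg.
rewrite [f in differentiable f _](_ : _ = h + \sum_i (mu i \*: g i)).
  by apply: differentiableD => //; apply: differentiable_sum => i;
     exact: differentiableZ.
by apply/funext => x; rewrite fctE fct_sumE.
Qed.

Lemma derive_lincomb p h (g : 'I_p -> V -> R^o) (mu : 'I_p -> R) z u :
  differentiable h z -> (forall i, differentiable (g i) z) ->
  'D_u (fun x => h x + \sum_i mu i * g i x : R^o) z =
  'D_u h z + \sum_i mu i * 'D_u (g i) z.
Proof.
move=> dh dg.
rewrite [f in 'D_u f _](_ : _ = h + \sum_i (mu i \*: g i)); last first.
  by apply/funext => x; rewrite fctE fct_sumE.
have dmg i : derivable (mu i \*: g i) z u.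
  by apply/diff_derivable/differentiableZ.
rewrite deriveD; [|exact: diff_derivable|]; last first.
  by apply: diff_derivable; apply: differentiable_sum => i; exact: differentiableZ.
rewrite derive_sum //; congr (_ + _); apply: eq_bigr => i _.
by rewrite deriveZ //; exact: diff_derivable.
Qed.

End normed.

(** Real-valued version of [egrad], to which it is convertible on [fine \o h]. *)
Definition grad n (h : 'cV[R]_n -> R^o) (x : 'cV[R]_n) : 'cV[R]_n :=
  \col_i 'D_(delta_mx i ord0) h x.

Lemma dotp_grad n (h : 'cV[R]_n -> R^o) x w :
  differentiable h x -> dotp (grad h x) w = 'D_w h x.
Proof.
move=> dh; rewrite deriveE // dotpE.
have {2}-> : w = \sum_i w i ord0 *: delta_mx i ord0.
  by rewrite [LHS]matrix_sum_delta; apply: eq_bigr => i _; rewrite big_ord1.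
rewrite linear_sum; apply: eq_bigr => i _.
by rewrite mxE deriveE // linearZ mulrC.
Qed.

Section partial.
Context {V W : normedModType R}.
Implicit Types (h : V * W -> R^o).

(** Both sides are the limit of the same difference quotients. *)
Lemma derive_partial_r h y x w :
  'D_w (fun x' => h (y, x') : R^o) x = 'D_(0, w) h (y, x).
Proof.
rewrite /derive; set F := (F in lim (F @ _)); set G := (G in _ = lim (G @ _)).
suff -> : F = G by [].
apply/funext => t; rewrite /F /G /=; congr (_ *: (h _ - _)).
by rewrite -[RHS]/(t *: 0 + y, t *: w + x) scaler0 add0r.
Qed.

Lemma differentiable_partial_l h y x : differentiable h (y, x) ->
  differentiable (fun y' => h (y', x) : R^o) y.
Proof.
move=> dh; rewrite (_ : (fun _ => _) = h \o (fun y' => (y', x))) //.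
exact: (@differentiable_comp _ _ _ _ (fun y' => (y', x)) h).
Qed.

Lemma differentiable_partial_r h y x : differentiable h (y, x) ->
  differentiable (fun x' => h (y, x') : R^o) x.
Proof.
move=> dh; rewrite (_ : (fun _ => _) = h \o (fun x' => (y, x'))) //.
exact: (@differentiable_comp _ _ _ _ (fun x' => (y, x')) h).
Qed.

End partial.

End directional_derivatives.

(** * Strong duality and subgradients of the value function *)

Section convex_programming.
Context {R : realType}.

Lemma relint_core_point n (Y : set 'cV[R]_n) z : relint Y z -> core_point Y z.
Proof.
move=> [Yz [e e0 ballY]]; split=> // y Yy.
pose s := e / (norm2 (z - y) + 1).
have N0 : 0 < norm2 (z - y) + 1 by rewrite ltr_wpDl ?norm2_ge0.
have s0 : 0 < s by rewrite divr_gt0.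
exists (1 + s); first by rewrite ltrDl.
apply: ballY.
  exists 2, (fun i : 'I_2 => if i == ord0 then 1 + s else 1 - (1 + s)),
    (fun i : 'I_2 => if i == ord0 then z else y); split.
  - by move=> i; case: ifP.
  - by rewrite !big_ord_recl big_ord0 /=; ring.
  - by rewrite !big_ord_recl big_ord0 /= addr0.
have -> : (1 + s) *: z + (1 - (1 + s)) *: y - z = s *: (z - y).
  by apply/matrixP => i j; rewrite !mxE; ring.
rewrite norm2Z ger0_norm ?ltW // /s mulrAC ltr_pdivrMr // mulrDr mulr1.
by rewrite ltrDl.
Qed.

(** Strong duality with an attained dual optimum. Slater's condition first
    dualises the inequalities over the points of [Y] satisfying the equations,
    leaving a function [psi] that [y0] minimises there. To dualise the equations
    in turn, a core point of [Y] is enough in general; when [Y] is a polyhedron,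
    [psi] may be replaced by its tangent at [y0], which makes the problem
    linear. *)
Lemma lagrange_multipliers n q p (Y : set 'cV[R]_n) (F : 'cV[R]_n -> R^o)
    (G : 'I_p -> 'cV[R]_n -> R^o) (A : 'M[R]_(q, n)) (c : 'cV[R]_q) ys y0 :
  convex_dom Y -> convex_fun Y F -> (forall i, convex_fun Y (G i)) ->
  Y ys -> A *m ys = c -> (forall i, G i ys < 0) ->
  polyhedral Y \/ core_point Y ys ->
  Y y0 -> A *m y0 = c -> (forall i, G i y0 <= 0) ->
  (forall y, Y y -> A *m y = c -> (forall i, G i y <= 0) -> F y0 <= F y) ->
  differentiable F y0 -> (forall i, differentiable (G i) y0) ->
  exists (lam : 'cV[R]_q) (mu : 'cV[R]_p), (forall i, 0 <= mu i ord0) /\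
    forall y, Y y ->
      F y0 <= F y + dotp lam (A *m y - c) + \sum_i mu i ord0 * G i y.
Proof.
move=> cY cF cG Yys Ays Gys Yqual Yy0 Ay0 Gy0 min0 dF dG.
pose ell i (y : 'cV[R]_n) := (A *m y - c) i ord0.
have affell i : affine_fun (ell i).
  move=> x y t; rewrite /ell mulmxDr -!scalemxAr !mxE; ring.
pose Z := [set y | Y y /\ A *m y = c].
have ZY : Z `<=` Y by move=> y [].
have cZ : convex_dom Z.
  move=> x y t [Yx Ax] [Yy Ay] t01; split; first exact: cY.
  by rewrite mulmxDr -!scalemxAr Ax Ay convex_comb_id.
have [|||||mu mu0 Zpos] := @inequality_multipliers R _ p G Z
    (fun y => F y + (- F y0)) ys cZ.
- apply: convex_funD; first exact: convex_funS cF.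
  by move=> x y t _ _ _; rewrite -mulrDl addrC subrK mul1r.
- by move=> i; exact: convex_funS (cG i).
- by [].
- exact: Gys.
- by move=> y [Yy Ay] Gy; rewrite subr_ge0; exact: min0.
pose psi y := F y + \sum_i mu i * G i y.
have cpsi : convex_fun Y psi.
  apply: convex_funD => //; apply: convex_fun_sum => i.
  exact: convex_funZ.
have psiy0 : psi y0 <= F y0.
  rewrite /psi gerDl sumr_le0 // => i _; exact: mulr_ge0_le0.
have Zpsi y : Z y -> F y0 <= psi y.
  by move=> /Zpos; rewrite addrAC subr_ge0.
suff [lam lamP] : exists lam : 'cV[R]_q, forall y, Y y ->
    0 <= psi y - F y0 + dotp lam (A *m y - c).
  exists lam, (\col_i mu i); split=> [i|y Yy]; first by rewrite mxE.
  under eq_bigr do rewrite mxE.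
  by have := lamP y Yy; rewrite /psi; lra.
case: Yqual => [[k [C [d YE]]]|ysc]; last first.
  have [|||||lam lamP] := @equality_multipliers R _ q ell Y
    (fun y => psi y - F y0) ys cY.
  - apply: convex_funD => // x y t _ _ _.
    by rewrite -mulrDl addrC subrK mul1r.
  - exact: affell.
  - exact: ysc.
  - by move=> i; rewrite /ell Ays subrr mxE.
  - move=> y Yy elly; rewrite subr_ge0 Zpsi //; split=> //.
    apply/eqP; rewrite -subr_eq0; apply/eqP/matrixP => i j.
    by rewrite ord1 [RHS]mxE; exact: elly.
  exists (\col_i lam i) => y Yy; rewrite dotpE.
  by under eq_bigr do rewrite mxE; exact: lamP.
have dpsi : differentiable (psi : _ -> R^o) y0 by exact: differentiable_lincomb.
have tangent y : Y y -> psi y0 + dotp (grad psi y0) (y - y0) <= psi y.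
  by move=> Yy; rewrite dotp_grad //; exact: (convex_fun_ge_tangent cpsi).
have [||lam lamP] := @polyhedral_multipliers R n k q C d A (grad psi y0) y0.
- by move: Yy0; rewrite YE.
- rewrite -YE => y Yy Ay; rewrite dotp_grad //.
  apply: (derive_ge dpsi ltr01) => t t0 t1; rewrite mulr0 addr0.
  apply: (le_trans psiy0); apply: Zpsi.
  rewrite segmentE.
  by apply: cZ => //; rewrite ?(ltW t0) ?t1 //; split; rewrite // Ay.
exists lam => y Yy.
have Fpsi : F y0 <= psi y0 by exact: Zpsi.
have := lamP y; rewrite -YE => /(_ Yy).
by rewrite mulmxBr Ay0; have := tangent y Yy; lra.
Qed.

(** Multipliers at [x0] give a subgradient of the value function: the Lagrangian
    is jointly convex, so it lies above its tangent at [(y0, x0)], and along [Y]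
    its derivative is nonnegative since [y0] minimises it there. *)
Lemma lagrangian_subgradient n m q p (X : set 'cV[R]_m) (Y : set 'cV[R]_n)
    (F : 'cV[R]_n * 'cV[R]_m -> R^o) (G : 'I_p -> 'cV[R]_n * 'cV[R]_m -> R^o)
    (A : 'M[R]_(q, n)) (B : 'M[R]_(q, m)) (b : 'cV[R]_q) y0 x0
    (lam : 'cV[R]_q) (mu : 'I_p -> R) :
  convex_dom Y -> convex_fun (Y `*` X) F ->
  (forall i, convex_fun (Y `*` X) (G i)) ->
  Y y0 -> X x0 -> A *m y0 + B *m x0 = b -> (forall i, G i (y0, x0) <= 0) ->
  differentiable F (y0, x0) -> (forall i, differentiable (G i) (y0, x0)) ->
  (forall i, 0 <= mu i) ->
  (forall y, Y y -> F (y0, x0) <=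
     F (y, x0) + dotp lam (A *m y + B *m x0 - b) + \sum_i mu i * G i (y, x0)) ->
  forall y x, Y y -> X x -> A *m y + B *m x = b -> (forall i, G i (y, x) <= 0) ->
    F (y0, x0) + dotp (grad (fun x' => F (y0, x')) x0 + B^T *m lam
      + \sum_i mu i *: grad (fun x' => G i (y0, x')) x0) (x - x0) <= F (y, x).
Proof.
move=> cY cF cG Yy0 Xx0 feas0 G0 dF dG mu0 saddle y x Yy Xx feas Gyx.
pose psi (z : 'cV[R]_n * 'cV[R]_m) : R^o := F z + \sum_i mu i * G i z.
have dpsi : differentiable psi (y0, x0) by exact: differentiable_lincomb.
have cpsi : convex_fun (Y `*` X) psi.
  apply: convex_funD => //; apply: convex_fun_sum => i.
  exact: convex_funZ.
have Ay : A *m (y - y0) = - (B *m (x - x0)).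
  apply/eqP; rewrite -subr_eq0 opprK !mulmxBr addrACA -opprD feas feas0.
  by rewrite subrr.
have tangent := convex_fun_ge_tangent cpsi (conj Yy0 Xx0 : (Y `*` X) (y0, x0))
  (conj Yy Xx : (Y `*` X) (y, x)) dpsi.
have dirE : (y, x) - (y0, x0) = (y - y0, 0) + (0, x - x0).
  by rewrite -[RHS]/(y - y0 + 0, 0 + (x - x0)) addr0 add0r.
rewrite dirE deriveDdir // in tangent.
have dy : - dotp lam (A *m (y - y0)) <= 'D_(y - y0, 0) psi (y0, x0).
  apply: (derive_ge dpsi ltr01) => t t0 t1.
  have -> : (y0, x0) + t *: (y - y0, 0) = (t *: y + (1 - t) *: y0, x0).
    rewrite -[LHS]/(y0 + t *: (y - y0), x0 + t *: 0) scaler0 addr0.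
    by rewrite segmentE.
  have Yt : Y (t *: y + (1 - t) *: y0) by apply: cY => //; rewrite ltW.
  have psi0 : psi (y0, x0) <= F (y0, x0).
    by rewrite /psi gerDl sumr_le0 // => i _; exact: mulr_ge0_le0.
  have := saddle _ Yt.
  have -> : A *m (t *: y + (1 - t) *: y0) + B *m x0 - b = t *: (A *m (y - y0)).
    rewrite -feas0 mulmxDr mulmxBr -!scalemxAr scalerBl scale1r scalerBr.
    by apply/matrixP => i j; rewrite !mxE; ring.
  by rewrite dotpZr; move: psi0; rewrite /psi; lra.
have dx : 'D_(0, x - x0) psi (y0, x0) =
    dotp (grad (fun x' => F (y0, x')) x0) (x - x0)
    + \sum_i mu i * dotp (grad (fun x' => G i (y0, x')) x0) (x - x0).
  rewrite derive_lincomb // dotp_grad; last exact: differentiable_partial_r.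
  rewrite derive_partial_r; congr (_ + _); apply: eq_bigr => i _.
  rewrite dotp_grad; last exact: differentiable_partial_r.
  by rewrite derive_partial_r.
have psi0 : F (y0, x0) <= psi (y0, x0).
  have := saddle y0 Yy0; rewrite feas0 subrr dotpC dotp0l addr0 => /le_trans.
  exact.
have psiyx : psi (y, x) <= F (y, x).
  by rewrite /psi gerDl sumr_le0 // => i _; exact: mulr_ge0_le0.
rewrite !dotpDl dotp_lincomb dotp_trmx.
have : dotp lam (A *m (y - y0)) = - dotp lam (B *m (x - x0)).
  by rewrite Ay dotpC dotpNl dotpC.
by rewrite dx in tangent; lra.
Qed.

Lemma compact_minimizer (T : topologicalType) (K : set T) (F : T -> R) :
  K !=set0 -> compact K -> {in K, continuous F} ->
  exists2 y, K y & forall z, K z -> F y <= F z.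
Proof.
move=> K0 cK cF.
have [y Ky ymin] := compact_EVT_min K0 cK (continuous_in_subspaceT cF).
by exists y => [|z Kz]; [exact: set_mem|apply: ymin; exact: mem_set].
Qed.

Lemma continuous_lincomb (T : topologicalType) I (r : seq I) (a : I -> R)
    (F : I -> T -> R) :
  (forall i, continuous (F i)) -> continuous (fun x => \sum_(i <- r) a i * F i x).
Proof.
move=> cF; elim: r => [|i r IH].
  rewrite (_ : (fun _ => _) = cst (0 : R)); first exact: cst_continuous.
  by apply/funext => x; rewrite big_nil.
rewrite (_ : (fun _ => _) = fun x =>
    a i * F i x + \sum_(j <- r) a j * F j x); last first.
  by apply/funext => x; rewrite big_cons.
by move=> x; apply: cvgD; [apply: cvgMl_tmp; exact: cF|exact: IH].
Qed.

Lemma continuous_mulmx_coord m n (A : 'M[R]_(m, n)) i :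
  continuous (fun y : 'cV[R]_n => (A *m y) i ord0).
Proof.
have -> : (fun y : 'cV[R]_n => (A *m y) i ord0) =
    fun y => \sum_j A i j * y j ord0 by apply/funext => y; rewrite mxE.
apply: (@continuous_lincomb _ _ _ _ (fun j (y : 'cV[R]_n) => y j ord0)) => j.
exact: coord_continuous.
Qed.

Lemma closed_linear_level m n (A : 'M[R]_(m, n)) c :
  closed [set y : 'cV[R]_n | A *m y = c].
Proof.
have -> : [set y : 'cV[R]_n | A *m y = c] =
    \bigcap_(i in [set: 'I_m]) [set y | (A *m y) i ord0 = c i ord0].
  apply/seteqP; split=> [y /= <- i //|y Ayc] /=.
  by apply/matrixP => i j; rewrite ord1; exact: Ayc.
apply: closed_bigI => i _.
apply: (@preimage_closed _ _ (fun y : 'cV[R]_n => (A *m y) i ord0)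
         [set r | r = c i ord0]); last exact: closed_eq.
by move=> y _; exact: continuous_mulmx_coord.
Qed.

Lemma closed_lsc_sublevel (T U : topologicalType) (g : T -> \bar R)
    (k : U -> T) : lower_semicontinuous g -> continuous k ->
  closed [set y | (g (k y) <= 0)%E].
Proof.
move=> /lower_semicontinuousP lg ck.
have -> : [set y | (g (k y) <= 0)%E] = ~` (k @^-1` [set z | (0 < g z)%E]).
  apply/seteqP; split=> y /=; first by move=> gy; apply/negP; rewrite -leNgt.
  by move=> /negP; rewrite -leNgt.
by apply: open_closedC; apply: open_comp; [move=> y _; exact: ck|exact: lg].
Qed.

End convex_programming.

(** * Approximate solutions and the inexact cut *)

Section approximate_solutions.
Context {R : realType}.

Lemma convex_set_dom (V : lmodType R) (S : set V) :
  @convex_set R V S -> convex_dom S.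
Proof.
move=> cS x y t Sx Sy /andP[t0 t1].
exact: set_mem (cS x y (Itv01 t0 t1) (mem_set Sx) (mem_set Sy)).
Qed.

Lemma convex_domX (V W : lmodType R) (S : set V) (T : set W) :
  convex_dom S -> convex_dom T -> convex_dom (S `*` T : set (V * W)%type).
Proof.
by move=> cS cT x y t [Sx Tx] [Sy Ty] t01; split; [exact: cS|exact: cT].
Qed.

Lemma econvex_fine (V : lmodType R) (S : set V) (h : V -> \bar R) :
  econvex_on setT h -> convex_dom S -> (forall x, S x -> h x \is a fin_num) ->
  convex_fun S (fine \o h).
Proof.
move=> ch cS hfin x y t Sx Sy t01; rewrite -lee_fin /=.
rewrite EFinD !EFinM !fineK ?hfin //; last exact: cS.
exact: ch.
Qed.

Lemma le_sqrt_ratio (a r s : R) : 0 < a -> 0 <= s -> 0 <= r ->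
  a / 2 * r ^+ 2 <= s -> r <= Num.sqrt (2 / a) * Num.sqrt s.
Proof.
move=> a0 s0 r0 ars.
have a20 : 0 <= 2 / a by rewrite divr_ge0 // ltW.
rewrite -sqrtrM // -(ger0_norm r0) -sqrtr_sqr ler_sqrt; last exact: mulr_ge0.
by rewrite mulrAC ler_pdivlMr //; move: ars; lra.
Qed.

(** Strong concavity between a maximiser and a near-maximiser controls their
    distance; the factor [1 - t] it leaves is removed by letting the
    intermediate point tend to the maximiser. *)
Lemma strongly_concave_near_max (V : lmodType R) (N : V -> R) (a e v : R)
    (D S : set V) (h : V -> \bar R) (z0 z : V) :
  0 < a -> 0 <= e -> strongly_concave_on N a D h -> convex_dom S ->
  S z0 -> S z -> D z0 -> D z -> h z0 = v%:E ->
  (forall z', S z' -> (h z' <= v%:E)%E) -> (v%:E - e%:E <= h z)%E ->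
  a / 2 * N (z0 - z) ^+ 2 <= e.
Proof.
move=> a0 e0 sc cS Sz0 Sz Dz0 Dz hz0 hle hz.
have hzle := hle _ Sz.
have hzfin : h z \is a fin_num.
  apply/fin_numP; split; apply/negP => /eqP hE; first by rewrite hE in hz.
  by rewrite hE in hzle.
have hzge : v - e <= fine (h z) by rewrite -lee_fin fineK.
set K := a / 2 * _; have K0 : 0 <= K.
  by rewrite mulr_ge0 ?sqr_ge0 // divr_ge0 // ltW.
have step t : 0 < t -> t < 1 -> (1 - t) * K <= e.
  move=> t0 t1; have t01 : 0 <= t <= 1 by rewrite !ltW.
  have h0fin : h z0 \is a fin_num by rewrite hz0.
  have := le_trans (sc z z0 t Dz Dz0 hzfin h0fin t01) (hle _ (cS _ _ _ Sz Sz0 t01)).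
  rewrite hz0 -(fineK hzfin) -!EFinM -!EFinD lee_fin => H.
  rewrite -(ler_pM2l t0); apply: le_trans (_ : t * (v - fine (h z)) <= _).
    by move: H; rewrite /K; lra.
  by rewrite ler_pM2l //; lra.
clearbody K; rewrite leNgt; apply/negP => eK.
have K0' : 0 < K by exact: le_lt_trans eK.
have := step ((K - e) / (2 * K)).
have -> : (1 - (K - e) / (2 * K)) * K = (K + e) / 2 by field; rewrite gt_eqF.
rewrite divr_gt0 ?subr_gt0 ?mulr_gt0 // => /(_ isT).
rewrite ltr_pdivrMr ?mulr_gt0 // mul1r.
have lt1 : K - e < 2 * K by lra.
by rewrite lt1 => /(_ isT); lra.
Qed.

(** With [s] the slacks of the constraints at a Slater point, the hypothesis is
    what the saddle point inequality says there, whence the classical bound on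
    the multipliers. For [p = 0] the infimum of the empty set and the inverse of
    [0] are both [0], and the bound is [0]. *)
Lemma multiplier_sum_le p (mu s : 'I_p -> R) (r : R) :
  (forall i, 0 <= mu i) -> (forall i, 0 < s i) -> \sum_i mu i * s i <= r ->
  \sum_i mu i <= r / inf (range s).
Proof.
case: p mu s => [|p] mu s mu0 s0 musr.
  rewrite big_ord0 (_ : range s = set0) ?inf0 ?invr0 ?mulr0 //.
  by apply/seteqP; split=> // x [[]].
pose j := [arg min_(i < ord0) s i]%O.
have sj i : s j <= s i by rewrite /j; case: arg_minP => // k _; exact.
have inf_pos : 0 < inf (range s).
  apply: (lt_le_trans (s0 j)); apply: lb_le_inf; first by exists (s ord0), ord0.
  by move=> _ [i _ <-].
have inf_le i : inf (range s) <= s i.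
  by apply: ge_inf; [exists (s j) => _ [k _ <-]|exists i].
rewrite ler_pdivlMr //; apply: (le_trans _ musr).
by rewrite mulr_suml; apply: ler_sum => i _; exact: ler_wpM2l.
Qed.

(** How far the slope of the cut moves when the exact primal and dual solutions
    are replaced by approximate ones. The multiplier terms are split as
    [mu g - mu' g' = (mu - mu') g + mu' (g - g')], so that only the exact
    multipliers, which Slater's condition bounds, meet the Lipschitz constant of
    the gradients. *)
Lemma slope_perturbation m q p (B : 'M[R]_(q, m)) (a a' w : 'cV[R]_m)
    (lam lam' : 'cV[R]_q) (mu mu' : 'cV[R]_p) (g g' : 'I_p -> 'cV[R]_m)
    (M1 M2 d U W : R) :
  norm2 (a - a') <= M1 * d -> (forall i, norm2 (g i - g' i) <= M2 * d) ->
  0 <= M2 * d -> (forall i, norm2 (g i) <= U) -> 0 <= U ->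
  (forall i, 0 <= mu' i ord0) -> \sum_i mu' i ord0 <= W ->
  dotp (a' + B^T *m lam' + \sum_i mu' i ord0 *: g' i) w
  - dotp (a + B^T *m lam + \sum_i mu i ord0 *: g i) w <=
  (M1 * d + M2 * d * W + Num.max (opnorm2 B^T) (Num.sqrt p%:R * U) *
    (Num.sqrt 2 * norm2_pair (lam' - lam, mu' - mu))) * norm2 w.
Proof.
move=> aa' gg' M2d gU U0 mu0 muW.
set K := Num.max _ _.
have w0 := norm2_ge0 w.
have -> : dotp (a' + B^T *m lam' + \sum_i mu' i ord0 *: g' i) w
    - dotp (a + B^T *m lam + \sum_i mu i ord0 *: g i) w =
    dotp (a' - a) w + \sum_i mu' i ord0 * dotp (g' i - g i) w
    + (dotp (B^T *m (lam' - lam)) w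
    + \sum_i (mu' - mu) i ord0 * dotp (g i) w).
  have -> : \sum_i (mu' - mu) i ord0 * dotp (g i) w =
      \sum_i mu' i ord0 * dotp (g i) w - \sum_i mu i ord0 * dotp (g i) w.
    by rewrite -sumrB; apply: eq_bigr => i _; rewrite !mxE mulrBl.
  have -> : \sum_i mu' i ord0 * dotp (g' i - g i) w =
      \sum_i mu' i ord0 * dotp (g' i) w - \sum_i mu' i ord0 * dotp (g i) w.
    by rewrite -sumrB; apply: eq_bigr => i _; rewrite dotpBl mulrBr.
  by rewrite mulmxBr !dotpDl !dotpNl !dotp_lincomb; ring.
rewrite !mulrDl; apply: lerD; first apply: lerD.
- apply: (le_trans (dotp_le_norm2 _ _)); rewrite ler_wpM2r //.
  by rewrite -norm2N opprB.
- apply: (@le_trans _ _ (\sum_i mu' i ord0 * (M2 * d * norm2 w))).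
    apply: ler_sum => i _; rewrite ler_wpM2l //.
    apply: (le_trans (dotp_le_norm2 _ _)); rewrite ler_wpM2r //.
    by rewrite -norm2N opprB.
  rewrite -mulr_suml mulrA ler_wpM2r // [leRHS]mulrC ler_wpM2r //.
- apply: (@le_trans _ _ ((K * (norm2 (lam' - lam) + norm2 (mu' - mu))) * norm2 w)).
    rewrite mulrDr mulrDl; apply: lerD.
      apply: (le_trans (dotp_le_norm2 _ _)); rewrite ler_wpM2r //.
      apply: (le_trans (norm2_le_opnorm2 _ _)).
      by rewrite ler_wpM2r ?norm2_ge0 // le_max lexx.
    apply: (@le_trans _ _ (\sum_i `|(mu' - mu) i ord0| * (U * norm2 w))).
      apply: ler_sum => i _; apply: (le_trans (ler_norm _)).
      rewrite normrM ler_wpM2l // ler_norml lerNl -dotpNl.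
      by apply/andP; split; apply: (le_trans (dotp_le_norm2 _ _));
        rewrite ?norm2N ler_wpM2r.
    rewrite -mulr_suml mulrA ler_wpM2r //.
    apply: (@le_trans _ _ (Num.sqrt p%:R * norm2 (mu' - mu) * U)).
      by rewrite ler_wpM2r // norm1_le_norm2.
    by rewrite mulrAC ler_wpM2r ?norm2_ge0 // le_max lexx orbT.
  rewrite ler_wpM2r // ler_wpM2l //; last first.
    exact: (norm2_add_le_pair (lam' - lam, mu' - mu)).
  by rewrite le_max mulr_ge0 ?sqrtr_ge0 ?orbT.
Qed.

End approximate_solutions.

Theorem proposition3p8 (R : realType) (n m q p : nat)
  (X : set 'cV[R]_m) (Y : set 'cV[R]_n)
  (X0 : X !=set0) (Xcompact : compact X) (Xconvex : @convex_set R 'cV[R]_m X)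
  (Y0 : Y !=set0) (Ycompact : compact Y) (Yconvex : @convex_set R 'cV[R]_n Y)
  (A : 'M[R]_(q, n)) (B : 'M[R]_(q, m)) (b : 'cV[R]_q)
  (f : 'cV[R]_n * 'cV[R]_m -> \bar R)
  (g : 'I_p -> 'cV[R]_n * 'cV[R]_m -> \bar R)
  (alpha M1 M2 alphaD : 'cV[R]_m -> R)
  (ys : 'cV[R]_m -> 'cV[R]_n)
  (D : 'cV[R]_m -> set ('cV[R]_q * 'cV[R]_p))
  (H1 : [/\ lower_semicontinuous f, eproper f & econvex_on setT f])
  (H2 : forall i, [/\ forall z, g i z != -oo%E,
                      econvex_on setT (g i) & lower_semicontinuous (g i)])
  (H3 : [/\ econvex_on (Y `*` X) f,
            forall y x, Y y -> X x -> ediff_at f (y, x) &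
            forall x, X x -> 0 < alpha x /\
              forall y1 y2, Y y1 -> Y y2 ->
                (f (y1, x) + (dotp (y2 - y1) (grady f y1 x))%:E
                   + (alpha x / 2 * norm2 (y2 - y1) ^+ 2)%:E
                 <= f (y2, x))%E])
  (H4 : (forall y, Y y -> forall x, X x ->
           ediff_at (fun x' => f (y, x')) x) /\
        (forall x, X x -> 0 <= M1 x /\
           forall y1 y2, Y y1 -> Y y2 ->
             norm2 (gradx f y2 x - gradx f y1 x) <= M1 x * norm2 (y2 - y1)))
  (H5 : (polyhedral Y -> forall x, X x ->
           [/\ Y (ys x), B *m x + A *m ys x = b &
               forall i, (g i (ys x, x) < 0)%E]) /\
        (~ polyhedral Y -> forall x, X x ->
           [/\ relint Y (ys x), B *m x + A *m ys x = b &
               forall i, (g i (ys x, x) < 0)%E]))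
  (H6 : forall x, X x ->
          [/\ 0 < alphaD x,
              @convex_set R ('cV[R]_q * 'cV[R]_p)%type (D x),
              argmax dual_feasible (dual_fun f g A B b Y x) `<=` D x &
              strongly_concave_on (@norm2_pair R q p) (alphaD x) (D x)
                (dual_fun f g A B b Y x)])
  (H7 : (forall i y x, Y y -> X x -> ediff_at (g i) (y, x)) /\
        (forall x, X x -> 0 <= M2 x /\
           forall y1 y2 i, Y y1 -> Y y2 ->
             norm2 (gradx (g i) y1 x - gradx (g i) y2 x)
             <= M2 x * norm2 (y1 - y2)))
  (xbar : 'cV[R]_m) (Xxbar : X xbar) (eps : R) (eps0 : 0 <= eps)
  (yhat : 'cV[R]_n)
  (yhat_opt : eps_argmin (feasible g A B b Y xbar) (fun y => f (y, xbar)) eps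
                yhat)
  (lamhat : 'cV[R]_q) (muhat : 'cV[R]_p)
  (dual_opt : eps_argmax dual_feasible (dual_fun f g A B b Y xbar) eps
                (lamhat, muhat))
  (dual_D : D xbar (lamhat, muhat))
  (Lxbar : R) (Lxbar_le : (Lxbar%:E <= value_fun f g A B b Y xbar)%E) :
  let U := \big[Num.max/0]_(i < p) norm2 (gradx (g i) yhat xbar) in
  (* for p = 0 the infimum is 0 and, division by 0 being 0, so is Uxbar: this
     agrees with the convention that the minimum of the empty set is +oo *)
  let Uxbar := (fine (f (ys xbar, xbar)) - Lxbar)
               / inf (range (fun i : 'I_p => - fine (g i (ys xbar, xbar)))) in
  let eta := eps
    + ((M1 xbar + M2 xbar * Uxbar) * Num.sqrt (2 / alpha xbar)
       + 2 * Num.max (opnorm2 B^T) (Num.sqrt p%:R * U)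
         / Num.sqrt (alphaD xbar)) * diam2 X * Num.sqrt eps in
  let C (x : 'cV[R]_m) := fine (f (yhat, xbar)) - eta
    + dotp (gradx f yhat xbar + B^T *m lamhat
            + \sum_(i < p) muhat i ord0 *: gradx (g i) yhat xbar)
           (x - xbar) in
  (forall x, X x -> ((C x)%:E <= value_fun f g A B b Y x)%E) /\
  (value_fun f g A B b Y xbar - (C xbar)%:E <= eta%:E)%E.
Proof.
move=> U Uxbar eta C.
have [_ [_ _] cvxf] := H1.
have [_ diff_f strongf] := H3.
have [_ lipf] := H4.
have [diff_g lipg] := H7.
have cX : convex_dom X by exact: convex_set_dom.
have cY : convex_dom Y by exact: convex_set_dom.
have cYX : convex_dom (Y `*` X) by exact: convex_domX.
pose F : _ -> R^o := fine \o f; pose G i : _ -> R^o := fine \o g i.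
have ffin y x : Y y -> X x -> f (y, x) \is a fin_num.
  by move=> Yy Xx; have [/nbhs_singleton] := diff_f y x Yy Xx.
have gfin i y x : Y y -> X x -> g i (y, x) \is a fin_num.
  by move=> Yy Xx; have [/nbhs_singleton] := diff_g i y x Yy Xx.
have fE y x : Y y -> X x -> f (y, x) = (F (y, x))%:E.
  by move=> Yy Xx; rewrite /F /= fineK // ffin.
have gE i y x : Y y -> X x -> g i (y, x) = (G i (y, x))%:E.
  by move=> Yy Xx; rewrite /G /= fineK // gfin.
have dF y x : Y y -> X x -> differentiable F (y, x).
  by move=> Yy Xx; have [] := diff_f y x Yy Xx.
have dG i y x : Y y -> X x -> differentiable (G i) (y, x).
  by move=> Yy Xx; have [] := diff_g i y x Yy Xx.
have cF : convex_fun (Y `*` X) F.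
  by apply: econvex_fine => // -[y x] [Yy Xx]; exact: ffin.
have cG i : convex_fun (Y `*` X) (G i).
  apply: econvex_fine => //; first by have [] := H2 i.
  by move=> -[y x] [Yy Xx]; exact: gfin.
have slice h x : X x -> convex_fun (Y `*` X) h ->
    convex_fun Y (fun y => h (y, x)).
  move=> Xx ch y y' t Yy Yy' t01.
  have := ch (y, x) (y', x) t (conj Yy Xx) (conj Yy' Xx) t01.
  rewrite [_ + _](_ : _ = (t *: y + (1 - t) *: y', x)) //.
  rewrite -[LHS]/(t *: y + (1 - t) *: y', t *: x + (1 - t) *: x).
  by rewrite convex_comb_id.
have [Yys Ays gys] : [/\ Y (ys xbar), B *m xbar + A *m ys xbar = b &
    forall i, (g i (ys xbar, xbar) < 0)%E].
  have [poly|npoly] := pselect (polyhedral Y).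
    by apply: H5.1.
  by have [[Yys _] ? ?] := H5.2 npoly _ Xxbar.
have Yqual : polyhedral Y \/ core_point Y (ys xbar).
  have [poly|npoly] := pselect (polyhedral Y); [by left|right].
  by apply: relint_core_point; have [] := H5.2 npoly _ Xxbar.
have Gys i : G i (ys xbar, xbar) < 0 by rewrite -lte_fin -gE.
pose K := feasible g A B b Y xbar.
have Kys : K (ys xbar).
  by split=> [//||i]; [rewrite addrC|exact: ltW].
have pair_cont : continuous (fun y : 'cV[R]_n => (y, xbar)).
  by move=> y; apply: differentiable_continuous; apply: differentiable_pair.
have Kcompact : compact K.
  have -> : K = Y `&` ([set y | A *m y = b - B *m xbar] `&`
      \bigcap_(i in [set: 'I_p]) [set y | (g i (y, xbar) <= 0)%E]).
    apply/seteqP; split=> y.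
      by move=> [Yy <- gy]; do 2!split=> //=; [rewrite addrK|move=> i _; exact: gy].
    move=> [Yy [/= Ay gy]]; split=> [//||i]; first by rewrite Ay subrK.
    exact: gy.
  apply: compact_closedI => //; apply: closedI; first exact: closed_linear_level.
  apply: closed_bigI => i _; apply: closed_lsc_sublevel => //.
  by have [] := H2 i.
have [y0 Ky0 y0min] : exists2 y, K y & forall z, K z -> F (y, xbar) <= F (z, xbar).
  apply: compact_minimizer => //; first by exists (ys xbar).
  move=> y /set_mem[Yy _ _]; apply: differentiable_continuous.
  exact/differentiable_partial_l/dF.
have [Yy0 Ay0 gy0] := Ky0.
pose v : R := F (y0, xbar).
have Gle x i y : Y y -> X x -> (g i (y, x) <= 0)%E -> G i (y, x) <= 0.
  by move=> Yy Xx; rewrite gE // lee_fin.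
have Kfeas y : Y y -> A *m y = b - B *m xbar ->
    (forall i, G i (y, xbar) <= 0) -> K y.
  move=> Yy Ay Gy; split=> [//||i]; first by rewrite Ay subrK.
  by rewrite gE // lee_fin.
have [lam [mu [mu0 saddle]]] : exists (lam : 'cV[R]_q) (mu : 'cV[R]_p),
    (forall i, 0 <= mu i ord0) /\
    forall y, Y y -> v <= F (y, xbar)
      + dotp lam (A *m y - (b - B *m xbar)) + \sum_i mu i ord0 * G i (y, xbar).
  apply: (@lagrange_multipliers _ _ _ _ Y (fun y => F (y, xbar))
    (fun i y => G i (y, xbar)) A (b - B *m xbar) (ys xbar) y0) => //.
  - exact: slice.
  - by move=> i; exact: slice.
  - by rewrite -Ays addrAC subrr add0r.
  - by rewrite -Ay0 addrK.
  - by move=> i; exact: Gle.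
  - by move=> y Yy Ay Gy; apply: y0min; exact: Kfeas.
  - exact/differentiable_partial_l/dF.
  - by move=> i; exact/differentiable_partial_l/dG.
have affE y : A *m y - (b - B *m xbar) = A *m y + B *m xbar - b.
  by rewrite opprB addrA.
have QE : value_fun f g A B b Y xbar = v%:E.
  apply/eqP; rewrite eq_le; apply/andP; split.
    by apply: ereal_inf_lbound; exists y0 => //; rewrite fE.
  apply: le_ereal_inf_tmp => _ [y Ky <-].
  by have [Yy _ _] := Ky; rewrite fE // lee_fin; exact: y0min.
have [Kyhat fyhat] := yhat_opt.
have [Yyhat Ayhat gyhat] := Kyhat.
have Fyhat : F (yhat, xbar) <= v + eps.
  by rewrite -lee_fin EFinD -QE -fE.
have vFyhat : v <= F (yhat, xbar) by exact: y0min.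
(* First-order optimality of y0 on the segment to yhat makes the linear term of
   the strong convexity inequality nonnegative. *)
have [alpha0 strongfx] := strongf _ Xxbar.
have gradF y x : grady f y x = grad (fun y' => F (y', x)) y by [].
have dist_primal : norm2 (yhat - y0) <= Num.sqrt (2 / alpha xbar) * Num.sqrt eps.
  apply: le_sqrt_ratio => //; first exact: norm2_ge0.
  have := strongfx y0 yhat Yy0 Yyhat; rewrite !fE // -!EFinD lee_fin gradF.
  have dFy0 : differentiable (fun y' => F (y', xbar) : R^o) y0.
    exact/differentiable_partial_l/dF.
  rewrite dotpC dotp_grad //.
  have : 0 <= 'D_(yhat - y0) (fun y' => F (y', xbar) : R^o) y0; last first.
    by rewrite -/v; lra.
  apply: (derive_ge dFy0 ltr01) => t t0 t1; rewrite mulr0 addr0.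
  apply: y0min.
  rewrite segmentE.
  have t01 : 0 <= t <= 1 by rewrite ltW.
  apply: Kfeas; first exact: cY.
    rewrite mulmxDr -!scalemxAr.
    have -> : A *m yhat = b - B *m xbar by rewrite -Ayhat addrK.
    have -> : A *m y0 = b - B *m xbar by rewrite -Ay0 addrK.
    by rewrite convex_comb_id.
  move=> i; apply: (le_trans (slice _ _ Xxbar (cG i) _ _ _ Yyhat Yy0 t01)).
  have := Gle _ i _ Yyhat Xxbar (gyhat i); have := Gle _ i _ Yy0 Xxbar (gy0 i).
  by move: t01; nra.
(* The saddle point inequality makes (lam, mu) an exact dual solution; hence it
   lies in D xbar and strong concavity compares it with (lamhat, muhat). *)
pose theta := dual_fun f g A B b Y xbar.
have thetaE (z : 'cV[R]_q * 'cV[R]_p) y : Y y -> (f (y, xbar) + (dotp z.1 (A *m y + B *m xbar - b)%R)%:E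
      + \sum_(i < p) ((z.2 i ord0)%:E * g i (y, xbar)))%E =
    (F (y, xbar) + dotp z.1 (A *m y + B *m xbar - b)
      + \sum_(i < p) z.2 i ord0 * G i (y, xbar))%:E.
  move=> Yy; rewrite fE // !EFinD -sumEFin; congr (_ + _)%E.
  by apply: eq_bigr => i _; rewrite gE.
have weak z : dual_feasible z -> (theta z <= v%:E)%E.
  move=> z0; apply: (@le_trans _ _ (F (y0, xbar) + dotp z.1 (A *m y0 + B *m xbar - b)
      + \sum_(i < p) z.2 i ord0 * G i (y0, xbar))%:E).
    by apply: ereal_inf_lbound; exists y0 => //; rewrite thetaE.
  rewrite lee_fin Ay0 subrr dotpC dotp0l addr0 gerDl sumr_le0 // => i _.
  by apply: mulr_ge0_le0; rewrite ?z0 // Gle.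
have theta0 : theta (lam, mu) = v%:E.
  apply/eqP; rewrite eq_le weak //=; apply: le_ereal_inf_tmp => _ [y Yy <-].
  by rewrite thetaE // lee_fin -affE; exact: saddle.
have supE : ereal_sup (theta @` dual_feasible) = v%:E.
  apply/eqP; rewrite eq_le; apply/andP; split.
    by apply: ge_ereal_sup => _ [z z0 <-]; exact: weak.
  by apply: ereal_sup_ubound; exists (lam, mu).
have [alphaD0 _ argD strongD] := H6 _ Xxbar.
have [dual_hat theta_hat] := dual_opt.
have dual_feasible_convex : convex_dom (@dual_feasible R q p).
  move=> z z' t z0 z'0 /andP[t0 t1] i /=; rewrite !mxE.
  by rewrite addr_ge0 // mulr_ge0 ?subr_ge0 ?z0 ?z'0.
have dist_dual : norm2_pair (lam - lamhat, mu - muhat) <=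
    Num.sqrt (2 / alphaD xbar) * Num.sqrt eps.
  apply: le_sqrt_ratio => //; first exact: norm2_ge0.
  apply: (@strongly_concave_near_max R ('cV[R]_q * 'cV[R]_p)%type
    (@norm2_pair R q p) (alphaD xbar) eps v (D xbar) dual_feasible theta
    (lam, mu) (lamhat, muhat)) => //.
  - by apply: argD; split=> //; rewrite supE.
  - by rewrite -supE.
have musum : \sum_i mu i ord0 <= Uxbar.
  apply: multiplier_sum_le => // [i|]; first by rewrite oppr_gt0 Gys.
  have Lv : Lxbar <= v by rewrite -lee_fin -QE.
  have ysb : A *m ys xbar + B *m xbar - b = 0 by rewrite -Ays [B *m _ + _]addrC subrr.
  have -> : \sum_i mu i ord0 * - fine (g i (ys xbar, xbar)) =
      - \sum_i mu i ord0 * G i (ys xbar, xbar).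
    by rewrite -sumrN; apply: eq_bigr => i _; rewrite mulrN.
  have := saddle _ Yys; rewrite affE ysb dotpC dotp0l addr0.
  set S : R := \sum_i _ => H.
  have {}H : v <= fine (f (ys xbar, xbar)) + S := H.
  by lra.
have [M10 lipfx] := lipf _ Xxbar.
have [M20 lipgx] := lipg _ Xxbar.
have U0 : 0 <= U by rewrite /U; elim/big_rec: _ => // i r _ r0; rewrite le_max r0 orbT.
(* The constant 2 of eta is sqrt 2 * sqrt 2: one factor comes from the sum of the
   two dual errors, the other from the strong concavity estimate. *)
have etaE : eta = eps + ((M1 xbar + M2 xbar * Uxbar) *
    (Num.sqrt (2 / alpha xbar) * Num.sqrt eps) +
    Num.max (opnorm2 B^T) (Num.sqrt p%:R * U) *
    (Num.sqrt 2 * (Num.sqrt (2 / alphaD xbar) * Num.sqrt eps))) * diam2 X.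
  have -> : Num.sqrt (2 / alphaD xbar) = Num.sqrt 2 / Num.sqrt (alphaD xbar).
    by rewrite sqrtrM ?ler0n // sqrtrV // ltW.
  have -> (r s : R) : Num.sqrt 2 * (Num.sqrt 2 * r * s) = 2 * r * s.
    by rewrite !mulrA -expr2 sqr_sqrtr ?ler0n.
  by rewrite /eta; ring.
split; last first.
  rewrite QE /C subrr dotpC dotp0l addr0 -EFinD lee_fin.
  by rewrite opprB addrCA gerDl subr_le0.
move=> x Xx; apply: le_ereal_inf_tmp => _ [y [Yy Ay gy] <-].
rewrite fE // lee_fin.
have sub := lagrangian_subgradient cY cF cG Yy0 Xxbar Ay0
  (fun i => Gle _ i _ Yy0 Xxbar (gy0 i)) (dF _ _ Yy0 Xxbar)
  (fun i => dG i _ _ Yy0 Xxbar) mu0.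
have {}sub := sub lam.
have {}sub : v + dotp (gradx f y0 xbar + B^T *m lam
    + \sum_i mu i ord0 *: gradx (g i) y0 xbar) (x - xbar) <= F (y, x).
  by apply: sub => // [z Yz|i]; [rewrite -affE; exact: saddle|exact: Gle].
have W0 : 0 <= Uxbar by apply: le_trans musum; apply: sumr_ge0.
have gU i : norm2 (gradx (g i) yhat xbar) <= U.
  exact: (le_bigmax _ (fun i => norm2 (gradx (g i) yhat xbar)) i).
(* Taken in the direction xbar - x, the perturbation bound compares the
   approximate slope to the exact one in the useful direction. *)
have pert := slope_perturbation B (xbar - x) lamhat lam muhat
  (lipfx _ _ Yy0 Yyhat) (fun i => lipgx _ _ i Yyhat Yy0)
  (mulr_ge0 M20 (norm2_ge0 _)) gU U0 mu0 musum.
set K' := Num.max _ _ in pert etaE.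
have K'0 : 0 <= K' by rewrite le_max mulr_ge0 ?sqrtr_ge0 ?orbT.
have opp u : dotp u (xbar - x) = - dotp u (x - xbar).
  by rewrite -opprB dotpC dotpNl dotpC.
rewrite !opp -[xbar - x]opprB norm2N in pert.
set d1 := norm2 (yhat - y0) in dist_primal pert.
set d2 := norm2_pair _ in dist_dual pert.
set r1 := _ * Num.sqrt eps in dist_primal etaE.
set r2 := _ * Num.sqrt eps in dist_dual etaE.
have werr : (M1 xbar * d1 + M2 xbar * d1 * Uxbar + K' * (Num.sqrt 2 * d2))
    * norm2 (x - xbar) <=
    ((M1 xbar + M2 xbar * Uxbar) * r1 + K' * (Num.sqrt 2 * r2)) * diam2 X.
  apply: ler_pM; rewrite ?norm2_ge0 //; last exact: norm2_le_diam2.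
    have d10 : 0 <= d1 by exact: norm2_ge0.
    have d20 : 0 <= d2 by exact: norm2_ge0.
    apply: addr_ge0; last by rewrite mulr_ge0 // mulr_ge0 ?sqrtr_ge0.
    by apply: addr_ge0; rewrite mulr_ge0 // mulr_ge0.
  apply: lerD; last by rewrite !ler_wpM2l ?sqrtr_ge0.
  rewrite mulrAC -mulrDl ler_wpM2l //.
  by rewrite addr_ge0 // mulr_ge0.
have := le_trans pert werr.
rewrite /C etaE.
set Shat := dotp _ _; set Sstar := dotp _ _ in sub *.
set Err := _ * diam2 X => Herr.
have final (fh w err sh ss r : R) : fh <= w + eps -> w + ss <= r ->
    - ss - - sh <= err -> fh - (eps + err) + sh <= r.
  by clear; lra.
exact: final Fyhat sub Herr.
Qed.
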